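(* Let $G$ be an infinite subgraph of a finite valence, bounded degree graph $\tilde G$ such that the boundary $\partial G$ is finite. Let $\tilde H(v_1,v_2;t)$ denote the heat kernel on $\tilde G$. Then the series $$\sum_{\ell=1}^{\infty}(-1)^{\ell}(L_{G,v_1}\tilde H)^{\ast\ell}(v_1,v_2;t)$$ converges absolutely and uniformly on any compact subset of $VG\times VG\times[0,\infty)$ and defines a function $\tilde F(v_1,v_2;t)$ on $VG\times VG\times[0,\infty)$. Furthermore, the heat kernel $H_G(v_1,v_2;t)$ on $G$ is given by $$H_G(v_1,v_2;t)=\tilde H(v_1,v_2;t)+(\tilde H\ast\tilde F)(v_1,v_2;t).$$
   Context: $\tilde G$ is a weighted graph with vertex set $V\tilde G$ (discrete topology) and symmetric weight function $\tilde w_{xy}=\tilde w_{yx}\in[0,\infty)$. Finite (bounded) valence means: for every $x$ the function $\tilde w(x,\cdot)$ has finite support, and $\tilde\mu(x)=\sum_{y\in V\tilde G}\tilde w_{xy}$ is uniformly bounded in $x\in V\tilde G$. Bounded degree means the number of $y$ with $\tilde w_{xy}>0$ is uniformly bounded in $x$. A subgraph $G$ is given by a subset $VG\subseteq V\tilde G$ and a (symmetric) weight function $w$ on $VG\times VG$ with each $w_{xy}$ equal either to $\tilde w_{xy}$ or to $0$. Put $\mu(x)=\sum_{y\in VG}w_{xy}$; the boundary is $\partial G=\{x\in VG:\mu(x)<\tilde\mu(x)\}$. Laplacians: $\Delta_{\tilde G}f(x)=\sum_{y\in V\tilde G}(f(x)-f(y))\tilde w_{xy}$ and $\Delta_Gf(x)=\sum_{y\in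 VG}(f(x)-f(y))w_{xy}$. $L_{G,v_1}=\Delta_{G,v_1}+\partial_t$ is the heat operator of $G$ acting in the first variable $v_1$; it is applied to the restriction of $\tilde H$ to $VG\times VG\times[0,\infty)$. The heat kernel of a graph $X$ (here $X=G$ or $\tilde G$) is the fundamental solution of $(\Delta_{X,v_1}+\partial_t)H_X(v_1,v_2;t)=0$ with $\lim_{t\to0}H_X(v_1,v_2;t)=\delta_{v_1=v_2}$; since $\tilde G$ has finite valence (each $\tilde w(x,\cdot)$ has finite support and $\tilde\mu(x)$ is uniformly bounded in $x$) and bounded degree (the number of $y$ with $\tilde w_{xy}>0$ is uniformly bounded in $x$), properties which the subgraph $G$ inherits, it exists and is unique (as bounded solution), and it is the kernel of the semigroup $e^{-t\Delta_X}$ on $L^2(VX)$ (counting measure). Convolution: $(F_1\ast F_2)(v_1,v_2;t)=\int_0^t\sum_{v\in VG}F_1(v_1,v;t-r)F_2(v,v_2;r)\,dr$; $(f)^{\ast1}=f$ and $(f)^{\ast\ell}=(f)^{\ast(\ell-1)}\ast f$ for $\ell\ge2$. (The sums appearing in the claim are finite, since $L_{G,v_1}\tilde H(v_1,v_2;t)$ vanishes for $v_1\notin\partial G$.) *)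

(* Defs.v *)
From mathcomp Require Import all_boot all_order all_algebra.
From mathcomp Require Import all_classical all_reals all_analysis.

Set Implicit Arguments.
Unset Strict Implicit.
Unset Printing Implicit Defensive.

Import Order.TTheory GRing.Theory Num.Theory.
Import numFieldNormedType.Exports.

Local Open Scope classical_set_scope.
Local Open Scope ring_scope.

(* A graph on a vertex set [X : set V] is a weight function [w : V -> V -> R]
   of which only the values on [X `*` X] are meaningful; likewise a kernel
   [H : V -> V -> R -> R] on such a graph is only meaningful on
   [X `*` X `*` `[0, +oo[].  The ambient graph has [X = setT]. *)
Section Graph.
Context {R : realType} {V : choiceType}.
Implicit Types (X : set V) (w : V -> V -> R) (f : V -> R)
  (H F : V -> V -> R -> R).

Definition weighted_graph X w :=
  forall x y, X x -> X y -> 0 <= w x y /\ w x y = w y x.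

Definition valence X w (x : V) : R := \sum_(y \in X) w x y.

Definition finite_valence X w :=
  (forall x, X x -> finite_set [set y | X y /\ w x y != 0]) /\
  (exists M : R, forall x, X x -> valence X w x <= M).

Definition bounded_degree X w :=
  exists N : nat, forall x, X x -> ([set y | X y /\ 0 < w x y] #<= `I_N)%card.

(* (X, w) is a subgraph of the ambient graph (setT, w'). *)
Definition subgraph X w w' :=
  weighted_graph X w /\
  (forall x y, X x -> X y -> w x y = w' x y \/ w x y = 0).

Definition boundary X w w' : set V :=
  [set x | X x /\ valence X w x < valence setT w' x].

Definition laplacian X w f (x : V) : R := \sum_(y \in X) (f x - f y) * w x y.

(* Derivative of a function defined on the half-line [0, +oo[: the usual
   derivative at t > 0, the right derivative at t = 0. *)
Definition time_derive (g : R -> R) (t : R) : R :=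
  lim ((g s - g t) / (s - t) @[s --> within `[0, +oo[ (t^')]).

(* The Laplacian acts on the first vertex variable. *)
Definition heat_op X w H (v1 v2 : V) (t : R) : R :=
  laplacian X w (fun u => H u v2 t) v1 + time_derive (H v1 v2) t.

(* The bounded fundamental solution of the heat equation, extended to t = 0 by
   its limit. *)
Record heat_kernel X w H : Prop := HeatKernel {
  heat_kernel_derivable : forall v1 v2 t, X v1 -> X v2 -> 0 < t ->
    derivable (H v1 v2) t 1;
  heat_kernel_eq : forall v1 v2 t, X v1 -> X v2 -> 0 < t ->
    heat_op X w H v1 v2 t = 0;
  heat_kernel_lim0 : forall v1 v2, X v1 -> X v2 ->
    H v1 v2 t @[t --> 0^'+] --> ((v1 == v2)%:R : R);
  heat_kernel_at0 : forall v1 v2, X v1 -> X v2 ->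
    H v1 v2 0 = (v1 == v2)%:R;
  heat_kernel_bounded : exists M : R, forall v1 v2 t, X v1 -> X v2 -> 0 <= t ->
    `|H v1 v2 t| <= M
}.

(* The sum over X is the sum over the support of the summand in X, and is 0 by
   convention when that support is infinite. *)
Definition graph_conv X F1 F2 (v1 v2 : V) (t : R) : R :=
  \int[lebesgue_measure]_(r in `[0, t])
    (\sum_(v \in X) F1 v1 v (t - r) * F2 v v2 r).

(* Meaningful for l >= 1 only. *)
Definition graph_conv_pow X F (l : nat) : V -> V -> R -> R :=
  iter l.-1 (fun G => graph_conv X G F) F.

(* [parametrix_term X w H k] is the term of index l = k + 1 of the series
   \sum_(l >= 1) (-1) ^ l (L_X H)^{graph_conv, l}. *)
Definition parametrix_term X w H (k : nat) (v1 v2 : V) (t : R) : R :=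
  (-1) ^+ k.+1 * graph_conv_pow X (heat_op X w H) k.+1 v1 v2 t.

End Graph.

(* Main.v *)
(* On the finite boundary [B] of the subgraph, the defect f = (Delta_G - Delta_Gt) Ht
   of the heat equation is supported in its first variable, bounded and continuous
   in time; so the convolution powers of f are convolutions of finite matrices of
   continuous functions, with f^{*(l+1)} = O((A |B| t)^l / l!).  Hence the series F
   converges locally uniformly, and associativity of the convolution turns
   f^{*l} * f into f * f^{*l}, so that F = - f - f * F.  Leibniz' rule for
   d/dt (Ht * F) then shows that K = Ht + Ht * F solves the heat equation on G with
   the right initial value.  K is only bounded locally in time by construction; the
   maximum principle for bounded Laplacians upgrades this to |K| <= 1, and also
   gives uniqueness. *)

Require Import Defs.
From mathcomp Require Import all_boot all_order all_algebra.
From mathcomp Require Import all_classical all_reals all_analysis.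
From mathcomp Require Import measurable_realfun ring lra.

Set Implicit Arguments.
Unset Strict Implicit.
Unset Printing Implicit Defensive.

Import Order.TTheory GRing.Theory Num.Theory.
Import numFieldNormedType.Exports.

Local Open Scope classical_set_scope.
Local Open Scope ring_scope.

(** * Primitives and convolution in one time variable: continuity *)

Section Convolution.
Context {R : realType}.
Implicit Types (a b c f F : R -> R) (t x y N M : R).

Local Notation mu := (@lebesgue_measure R).

(** Graph kernels are meaningful only on [X] and at times [t >= 0], and a heat kernel is
    differentiable only for [t > 0]. The analysis is therefore run on total functions: kernels are
    frozen at their initial value for negative times, weights are extended by 0, and infinite vertex
    sums become sums over a list. All entries are then continuous on the whole line, which settles
    integrability on segments, and the graph statements are recovered by agreement on [X] and
    [t >= 0]. Time 0 cannot be discarded, since the series is claimed there too; differential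
    equations are for this reason traded for integral ones, which hold down to 0. On an infinite
    vertex set a supremum need not be attained, so the maximum principle cannot look at a maximum
    point and iterates an inequality in time instead; its starting point is a bound local in time
    but uniform in the vertices, which the factorial estimate supplies. *)

Lemma cvg_continuous_comp (T : Type) (F : set_system T) {FF : Filter F}
    (f : T -> R) a (l : R) :
  continuous a -> f x @[x --> F] --> l -> a (f x) @[x --> F] --> a l.
Proof. move=> ca; exact: (@continuous_cvg _ _ _ F FF f a l (ca l)). Qed.

(** For negative [t] the segment is empty and the value is 0, so that primitives and convolutions
    are continuous on the whole line and can be convolved again. *)
Definition prim f t := \int[mu]_(r in `[0, t]) f r.

Definition tconv a b t := \int[mu]_(r in `[0, t]) (a (t - r) * b r).

Lemma continuous_integrable f x y :
  continuous f -> mu.-integrable `[x, y] (EFin \o f).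
Proof.
move=> cf; apply: continuous_compact_integrable; first exact: segment_compact.
exact: continuous_subspaceT.
Qed.

Lemma continuous_bounded_itv f N :
  continuous f -> exists M, forall x, `|x| <= N -> `|f x| <= M.
Proof.
move=> cf; have [N0|N0] := ltP N 0.
  by exists 0 => x /le_lt_trans /(_ N0); rewrite ltNge normr_ge0.
have cnf : {within `[(- N), N], continuous (fun x => `|f x|)}.
  apply: continuous_subspaceT => x; apply: (@continuous_comp _ _ _ f Num.norm).
    exact: cf.
  exact: norm_continuous.
have NN : - N <= N by lra.
have [c cN cmax] := EVT_max NN cnf.
by exists `|f c| => x xN; apply: cmax; rewrite in_itv/= -ler_norml.
Qed.

Lemma prim0 f t : t <= 0 -> prim f t = 0.
Proof.
rewrite /prim le_eqVlt => /predU1P[->|t0].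
  by rewrite set_itv1 Rintegral_set1.
by rewrite set_itv_ge ?Rintegral_set0// bnd_simp -ltNge.
Qed.

Lemma tconv0 a b t : t <= 0 -> tconv a b t = 0.
Proof. exact: prim0. Qed.

Lemma prim_continuous f : continuous f -> continuous (prim f).
Proof.
move=> cf t; pose N := `|t| + 1.
have NN : - N <= N by rewrite /N; have := normr_ge0 t; lra.
(* Once [f] is cut off below 0, its integral from [- N] agrees with [prim f] at negative times as
   well, so continuity at 0 is not a separate case. *)
pose g := f \_ `[0, +oo[.
have ig : mu.-integrable `[- N, N] (EFin \o g).
  rewrite /g -restrict_EFin; apply/integrable_restrict => //.
  have := continuous_integrable (- N) N cf; apply: integrableS => //.
    exact: measurableI.
have gE x : - N <= x -> x <= N -> prim f x = parameterized_integral mu (- N) x g.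
  move=> Nx xN; rewrite /prim /parameterized_integral /g -Rintegral_mkcondr.
  congr (Rintegral _ _ _); apply/seteqP; split => r /=; rewrite !in_itv/=.
    by move=> /andP[r0 ->]; rewrite r0/=; split=> //; rewrite andbT; lra.
  by move=> [/andP[_ ->]]; rewrite andbT => ->.
have tN : t \in (`]- N, N[ : interval R).
  by rewrite in_itv/= -ltr_norml /N; lra.
have NltN : - N < N by rewrite /N; have := normr_ge0 t; lra.
have gt := within_continuous_continuous NltN
  (parameterized_integral_continuous NN ig) tN.
rewrite /prop_for /continuous_at gE; first last.
- by move: tN; rewrite in_itv/= => /andP[_ /ltW].
- by move: tN; rewrite in_itv/= => /andP[/ltW].
apply: cvg_trans gt; apply: near_eq_cvg.
near=> x; rewrite gE//.
  by apply: ltW; near: x; apply: lt_nbhsr; move: tN; rewrite in_itv/= => /andP[].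
by apply: ltW; near: x; apply: lt_nbhsl; move: tN; rewrite in_itv/= => /andP[].
Unshelve. all: by end_near. Qed.

Lemma continuous_tconv_integrand a b t : continuous a -> continuous b ->
  continuous (fun r => a (t - r) * b r).
Proof.
move=> ca cb r; apply: cvgM; last exact: cb.

apply: (@continuous_comp _ _ _ (fun r => t - r) a); last exact: ca.
by apply: cvgB; [exact: cvg_cst|exact: cvg_id].
Qed.

Lemma continuous_max0 a : continuous a -> continuous (fun t => a (Num.max 0 t)).
Proof.
move=> ca t; apply: (cvg_continuous_comp ca).
apply: (@continuous_max R R (cst 0) id); first exact: cvg_cst.
exact: cvg_id.
Qed.

Lemma tconv_continuous a b :
  continuous a -> continuous b -> continuous (tconv a b).
Proof.
move=> ca cb t; pose N := `|t| + 1.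
have N0 : 0 < N by rewrite /N; have := normr_ge0 t; lra.
(* Subtracting the jump of [a] at 0 makes the integrand continuous in [s]. *)
pose a0 x := a (Num.max 0 x) - a 0.
have ca0 : continuous a0.
  by move=> x; apply: cvgB; [exact: continuous_max0|exact: cvg_cst].
(* For [r >= s] the factor [a0 (s - r)] is 0, so the moving domain [[0, s]] becomes the fixed
   [[0, N]], and dominated convergence gives the continuity of [G]. *)
pose G s := \int[mu]_(r in `[0, N]) (a0 (s - r) * b r).
have E s : s <= N -> tconv a b s = G s + a 0 * prim b s.
  move=> sN; rewrite /tconv /prim /G -RintegralZl//; last exact: continuous_integrable.
  rewrite (_ : \int[mu]_(r in `[0, N]) _ =
      \int[mu]_(r in `[0, s]) (a0 (s - r) * b r)).
    rewrite -RintegralD//; first last.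
    - apply: continuous_integrable => r.
      by apply: cvgM; [exact: cvg_cst|exact: cb].
    - exact/continuous_integrable/continuous_tconv_integrand.
    apply: eq_Rintegral => r; rewrite inE/= in_itv/= => /andP[r0 rs].
    by rewrite /a0 max_r; [ring|lra].
  rewrite (_ : `[0, s]%classic = `[0, N] `&` `[0, s]); last first.
    apply/seteqP; split => r /=; rewrite !in_itv/=; last by case.
    by move=> /andP[-> rs]; rewrite rs; split=> //; apply: le_trans sN.
  rewrite Rintegral_mkcondr; apply: eq_Rintegral => r; rewrite inE/= in_itv/=.
  move=> /andP[r0 rN]; rewrite patchE; case: ifPn => //.
  rewrite notin_setE/= in_itv/= r0/= => /negP; rewrite -ltNge => sr.
  by rewrite /a0 max_l ?subrr ?mul0r//; lra.
have cG : {for t, continuous G}.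
  have [Ma MaE] := continuous_bounded_itv (N + N) ca0.
  have [Mb MbE] := continuous_bounded_itv N cb.
  apply: (@continuity_under_integral _ _ _ mu (fun s r => a0 (s - r) * b r)
    `[0, N]%classic _ (- N) N _ _ (cst (Ma * Mb))) => //.
  - by move=> s _; exact/continuous_integrable/continuous_tconv_integrand.
  - apply: aeW => r _ s _; apply: cvgM; last exact: cvg_cst.
    apply: (cvg_continuous_comp ca0).
    by apply: cvgB; [exact: cvg_id|exact: cvg_cst].
  - by apply: continuous_integrable => x; exact: cvg_cst.
  - move=> s; rewrite /= in_itv/= => /andP[Ns sN]; apply: aeW => r.
    rewrite /= in_itv/= => /andP[r0 rN]; rewrite normrM ler_pM//.
      by apply: MaE; rewrite ler_norml; lra.
    by apply: MbE; rewrite ler_norml; lra.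
  - by rewrite inE/= in_itv/= -ltr_norml /N; lra.
rewrite /continuous_at E; last by rewrite /N; have := ler_norm t; lra.
have : G s + a 0 * prim b s @[s --> t] --> G t + a 0 * prim b t.
  apply: cvgD; first exact: cG.
  by apply: cvgM; [exact: cvg_cst|exact: prim_continuous].
apply: cvg_trans; apply: near_eq_cvg; near=> s; rewrite E//.
apply: ltW; near: s; apply: lt_nbhsl; rewrite /N; have := ler_norm t; lra.
Unshelve. all: by end_near. Qed.

End Convolution.

(** * Linearity, estimates and the fundamental theorem for convolutions *)

Section ConvolutionTheory.
Context {R : realType}.
Implicit Types (a b c f g F : R -> R) (t x y N M k r s A : R).

Local Notation mu := (@lebesgue_measure R).

Lemma eq_prim f g t : (forall r, 0 <= r -> r <= t -> f r = g r) ->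
  prim f t = prim g t.
Proof.
move=> fg; apply: eq_Rintegral => r; rewrite inE/= in_itv/= => /andP[r0 rt].
exact: fg.
Qed.

Lemma eq_tconv a a' b b' t :
  (forall r, 0 <= r -> r <= t -> a r = a' r) ->
  (forall r, 0 <= r -> r <= t -> b r = b' r) ->
  tconv a b t = tconv a' b' t.
Proof.
move=> aa' bb'; apply: eq_prim => r r0 rt; rewrite aa' ?bb' ?subr_ge0//.
by rewrite lerBlDr lerDl.
Qed.

Lemma continuous_sum (I : Type) (s : seq I) (f : I -> R -> R) :
  (forall i, continuous (f i)) -> continuous (fun r => \sum_(i <- s) f i r).
Proof.
move=> cf; elim: s => [|i s IH].
  under eq_fun do rewrite big_nil.
  by move=> r; exact: cvg_cst.
under eq_fun do rewrite big_cons.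
by move=> r; apply: cvgD; [exact: cf|exact: IH].
Qed.

Lemma continuous_funD f g : continuous f -> continuous g ->
  continuous (fun r => f r + g r).
Proof. by move=> cf cg r; apply: cvgD; [exact: cf|exact: cg]. Qed.

Lemma continuous_funB f g : continuous f -> continuous g ->
  continuous (fun r => f r - g r).
Proof. by move=> cf cg r; apply: cvgB; [exact: cf|exact: cg]. Qed.

Lemma continuous_funM f g : continuous f -> continuous g ->
  continuous (fun r => f r * g r).
Proof. by move=> cf cg r; apply: cvgM; [exact: cf|exact: cg]. Qed.

Lemma continuousZ k f : continuous f -> continuous (fun r => k * f r).
Proof. by move=> cf r; apply: cvgM; [exact: cvg_cst|exact: cf]. Qed.

Lemma primD f g t : continuous f -> continuous g ->
  prim (fun r => f r + g r) t = prim f t + prim g t.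
Proof.
by move=> cf cg; rewrite /prim RintegralD//; exact: continuous_integrable.
Qed.

Lemma primZ k f t : continuous f -> prim (fun r => k * f r) t = k * prim f t.
Proof. by move=> cf; rewrite /prim RintegralZl//; exact: continuous_integrable. Qed.

Lemma prim_sum (I : Type) (s : seq I) (f : I -> R -> R) t :
  (forall i, continuous (f i)) ->
  prim (fun r => \sum_(i <- s) f i r) t = \sum_(i <- s) prim (f i) t.
Proof.
move=> cf; elim: s => [|i s IH].
  rewrite big_nil -[RHS](mul0r (prim (cst 0) t)) -primZ; last by move=> x; exact: cvg_cst.
  by apply: eq_prim => r _ _; rewrite big_nil /= mul0r.
rewrite big_cons -IH -primD//; last exact: continuous_sum.
by apply: eq_prim => r _ _; rewrite big_cons.
Qed.

Lemma tconvZl k a b t : continuous a -> continuous b ->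
  tconv (fun r => k * a r) b t = k * tconv a b t.
Proof.
move=> ca cb; rewrite /tconv -primZ; last exact: continuous_tconv_integrand.
by apply: eq_prim => r _ _; rewrite mulrA.
Qed.

Lemma tconvZr k a b t : continuous a -> continuous b ->
  tconv a (fun r => k * b r) t = k * tconv a b t.
Proof.
move=> ca cb; rewrite /tconv -primZ; last exact: continuous_tconv_integrand.
by apply: eq_prim => r _ _; rewrite mulrCA.
Qed.

Lemma tconv_suml (I : Type) (s : seq I) (a : I -> R -> R) b t :
  (forall i, continuous (a i)) -> continuous b ->
  tconv (fun r => \sum_(i <- s) a i r) b t = \sum_(i <- s) tconv (a i) b t.
Proof.
move=> ca cb; rewrite /tconv -prim_sum.
  by apply: eq_prim => r _ _; rewrite mulr_suml.
by move=> i; exact: continuous_tconv_integrand.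
Qed.

Lemma tconv_sumr (I : Type) (s : seq I) a (b : I -> R -> R) t :
  continuous a -> (forall i, continuous (b i)) ->
  tconv a (fun r => \sum_(i <- s) b i r) t = \sum_(i <- s) tconv a (b i) t.
Proof.
move=> ca cb; rewrite /tconv -prim_sum.
  by apply: eq_prim => r _ _; rewrite mulr_sumr.
by move=> i; exact: continuous_tconv_integrand.
Qed.

Lemma tconvDl a a' b t : continuous a -> continuous a' -> continuous b ->
  tconv (fun r => a r + a' r) b t = tconv a b t + tconv a' b t.
Proof.
move=> ca ca' cb; rewrite /tconv -primD; try exact: continuous_tconv_integrand.
by apply: eq_prim => r _ _; rewrite mulrDl.
Qed.

Lemma tconvBl a a' b t : continuous a -> continuous a' -> continuous b ->
  tconv (fun r => a r - a' r) b t = tconv a b t - tconv a' b t.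
Proof.
move=> ca ca' cb; rewrite -[X in _ - X]mul1r -mulNr -tconvZl// -tconvDl//.
  by apply: eq_tconv => // r _ _; rewrite mulN1r.
exact: continuousZ.
Qed.

Lemma tconvBr a b b' t : continuous a -> continuous b -> continuous b' ->
  tconv a (fun r => b r - b' r) t = tconv a b t - tconv a b' t.
Proof.
move=> ca cb cb'; rewrite /tconv /Rintegral.
rewrite -[RHS]RintegralB//; try exact/continuous_integrable/continuous_tconv_integrand.
by apply: eq_prim => r _ _; rewrite mulrBr.
Qed.

Lemma tconv_cst k b t : continuous b -> tconv (cst k) b t = k * prim b t.
Proof. by move=> cb; rewrite -primZ. Qed.

Lemma le_prim f g t : continuous f -> continuous g ->
  (forall r, 0 <= r -> r <= t -> `|f r| <= g r) -> `|prim f t| <= prim g t.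
Proof.
move=> cf cg fg; apply: le_trans (le_normr_Rintegral _ _) _ => //.
  exact: continuous_integrable.
apply: le_Rintegral => //; last 2 first.
- exact: continuous_integrable.
- by move=> r; rewrite /= in_itv/= => /andP[]; exact: fg.
apply: (@continuous_integrable _ (fun x => `|f x|)) => x.
exact: cvg_norm (cf x).
Qed.

(** Continuity at 0 compensates for the missing derivative there: this is the regularity that a heat
    kernel has once extended to negative times. *)
Lemma prim_FTC2 f F t : continuous f -> continuous F ->
  (forall s, 0 < s -> is_derive s 1 F (f s)) -> 0 <= t ->
  prim f t = F t - F 0.
Proof.
move=> cf cF dF; rewrite le_eqVlt => /predU1P[<-|t0]; first by rewrite subrr prim0.
rewrite /prim /Rintegral (@continuous_FTC2 _ f F)//.
- exact: continuous_subspaceT.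
- split; [|exact/cvg_at_right_filter/cF|exact/cvg_at_left_filter/cF].
  by move=> s; rewrite in_itv/= => /andP[s0 _]; have [] := dF s s0.
- move=> s; rewrite in_itv/= => /andP[s0 _]; rewrite derive1E.
  by have := dF s s0 => ?; rewrite derive_val.
Qed.

Lemma prim_is_derive f t : continuous f -> 0 < t -> is_derive t 1 (prim f) (f t).
Proof.
move=> cf t0.
have [||//|d e] := @continuous_FTC1_closed _ f 0 t (t + 1) _ _ t0.
- by lra.
- exact: continuous_integrable.
- exact: cf.
- by apply: DeriveDef => //; rewrite -derive1E.
Qed.

(** The functions [(k s)^n / n!] reproduce themselves under integration against [k], with [n] raised
    by one. They majorize both the convolution powers and the iteration in the maximum principle. *)
Lemma is_derive_exp_coeff k (n : nat) t :
  is_derive t 1 (fun s : R => (k * s) ^+ n.+1 / n.+1`!%:R)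
    (k * ((k * t) ^+ n / n`!%:R)).
Proof.
have dk : is_derive t 1 ( *%R k) k.
  by apply: is_derive_eq; rewrite /GRing.scale/= mulr1.
have -> : (fun s : R => (k * s) ^+ n.+1 / n.+1`!%:R) =
    (( *%R k) ^+ n.+1) * cst (n.+1`!%:R^-1).
  by apply/funext => s; rewrite mulrfctE exprfctE.
apply: (is_derive_eq (is_deriveM (is_deriveX n.+1 dk)
  (is_derive_cst (n.+1`!%:R^-1 : R) t 1))).
rewrite scaler0 add0r /GRing.scale/= factS natrM invfM.
have n0 : n`!%:R != 0 :> R by rewrite pnatr_eq0 -lt0n fact_gt0.
by field; rewrite n0/= nat1r pnatr_eq0.
Qed.

Lemma continuous_exp_coeff k (n : nat) :
  continuous (fun s : R => (k * s) ^+ n / n`!%:R).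
Proof.
move=> s; apply: cvgM; last exact: cvg_cst.
have : continuous (fun x : R => x ^+ n) by exact: exprn_continuous.
move=> cn; apply: (cvg_continuous_comp cn).
by apply: cvgM; [exact: cvg_cst|exact: cvg_id].
Qed.

Lemma prim_exp_coeff k (n : nat) t : 0 <= t ->
  prim (fun s => k * ((k * s) ^+ n / n`!%:R)) t = (k * t) ^+ n.+1 / n.+1`!%:R.
Proof.
pose F s := (k * s) ^+ n.+1 / n.+1`!%:R.
move=> t0; rewrite -[RHS]/(F t); have <- : F t - F 0 = F t.
  by rewrite /F mulr0 expr0n/= mul0r subr0.
apply: prim_FTC2 => //.
- exact/continuousZ/continuous_exp_coeff.
- exact: continuous_exp_coeff.
- by move=> s _; exact: is_derive_exp_coeff.
Qed.

(** The asymmetric bounds, constant on the left and time dependent on the right, fit the induction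
    on the powers written as [f * f^{*l}]. *)
Lemma le_tconv a b g t A : continuous a -> continuous b -> continuous g ->
  (forall r, 0 <= r -> r <= t -> `|a r| <= A) ->
  (forall r, 0 <= r -> r <= t -> `|b r| <= g r) ->
  `|tconv a b t| <= prim (fun r => A * g r) t.
Proof.
move=> ca cb cg aA bg; apply: le_prim.
- exact: continuous_tconv_integrand.
- exact: continuousZ.
- move=> r r0 rt; rewrite normrM ler_pM//; last exact: bg.
  by apply: aA; rewrite ?subr_ge0// lerBlDr lerDl.
Qed.

Lemma prim_cst k t : 0 <= t -> prim (fun _ => k) t = k * t.
Proof.
move=> t0; rewrite -[RHS]subr0 -(mulr0 k); apply: (prim_FTC2 (F := *%R k)) => //.
- by move=> ?; exact: cvg_cst.
- by move=> s; apply: cvgM; [exact: cvg_cst|exact: cvg_id].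
- by move=> s _; apply: is_derive_eq; rewrite /GRing.scale/= mulr1.
Qed.

Lemma le_tconv_cst a b t A B : continuous a -> continuous b ->
  (forall r, 0 <= r -> r <= t -> `|a r| <= A) ->
  (forall r, 0 <= r -> r <= t -> `|b r| <= B) -> 0 <= t ->
  `|tconv a b t| <= A * B * t.
Proof.
move=> ca cb aA bB t0.
have cc (c : R) : continuous (fun _ : R => c) by move=> ?; exact: cvg_cst.
by rewrite -prim_cst//; exact: le_tconv (cc B) aA bB.
Qed.

End ConvolutionTheory.

(** * Associativity of the convolution and Leibniz' rule *)

Section ConvolutionAssoc.
Context {R : realType}.
Implicit Types (a b c f F : R -> R) (t x y N M k r s : R).

Local Notation mu := (@lebesgue_measure R).

Lemma EFin_Rintegral f x y : continuous f ->
  (\int[mu]_(r in `[x, y]) f r)%:E = (\int[mu]_(r in `[x, y]) (f r)%:E)%E.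
Proof.
move=> cf; rewrite /Rintegral fineK//.
by apply: integrable_fin_num => //; exact: continuous_integrable.
Qed.

(** Fubini for [g] cut off to the triangle [0 <= s <= r <= t], a set of finite measure on which [g]
    is bounded. Continuity in each variable identifies the real inner integrals with the extended
    ones. *)
Lemma Rintegral_triangle_swap (g : R * R -> R) t M :
  measurable_fun setT g ->
  (forall r, continuous (fun s => g (r, s))) ->
  (forall s, continuous (fun r => g (r, s))) ->
  (forall r s, 0 <= s -> s <= r -> r <= t -> `|g (r, s)| <= M) ->
  \int[mu]_(r in `[0, t]) (\int[mu]_(s in `[0, r]) g (r, s)) =
  \int[mu]_(s in `[0, t]) (\int[mu]_(r in `[s, t]) g (r, s)).
Proof.
move=> mg cgr cgs gM.
pose D := [set p : R * R | (0 <= p.2 /\ p.2 <= p.1) /\ p.1 <= t].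
have mD : measurable D.
  have -> : D = ((setT `&` [set p | cst 0 p <= snd p]) `&`
     (setT `&` [set p | snd p <= fst p])) `&` (setT `&` [set p | fst p <= cst t p]).
    by apply/seteqP; split => p /=; rewrite /D/=; tauto.
  by apply: measurableI; [apply: measurableI|]; apply: measurable_fun_le.
pose h := g \_ D.
have ih : (mu \x mu)%E.-integrable setT (EFin \o h).
  rewrite /h -restrict_EFin; apply: (@integrable_mkcond _ _ R (mu \x mu)%E D (EFin \o g) mD).1.
  apply: measurable_bounded_integrable => //.
  - apply: (@le_lt_trans _ _ ((mu \x mu)%E (`[0, t] `*` `[0, t]))).
      apply: le_measure; rewrite ?inE//; first exact: measurableX.
      by move=> [r s] [[/= s0 sr] rt]; rewrite /= !in_itv/= s0 rt !(le_trans _ rt, le_trans s0).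
    have fI : (mu `[0%R, t] < +oo)%E.
      by rewrite lebesgue_measure_itv/=; case: ifP => _; rewrite ?ltry// -EFinB ltry.
    by rewrite product_measure1E// lte_mul_pinfty// ge0_fin_numE.
  - exact: measurable_funTS.
  - exists M; split; first exact: num_real.
    move=> N MN [r s] [[/= s0 sr] rt] /=.
    by apply: le_trans (ltW MN); exact: gM.
have {}ih := Fubini ih.
have EL : (\int[mu]_(r in `[0%R, t]) (\int[mu]_(s in `[0, r]) g (r, s))%:E =
    \int[mu]_r \int[mu]_s (h (r, s))%:E)%E.
  rewrite integral_mkcond; apply: eq_integral => r _; rewrite patchE.
  case: ifPn => [|/negP]; rewrite inE/= in_itv/=.
    move=> /andP[r0 rt]; rewrite EFin_Rintegral// integral_mkcond.
    apply: eq_integral => s _; rewrite /h !patchE.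
    rewrite (_ : (s \in _) = ((r, s) \in D)); first by case: ifP.
    by apply/idP/idP; rewrite !inE/D/= in_itv/=; [move=> /andP[]|move=> [[-> ->]]].
  move=> rt; rewrite integral0_eq// => s _; rewrite /h patchE ifF//.
  apply/negP; rewrite inE => -[[/= s0 sr] rt']; apply: rt.
  by rewrite rt' (le_trans s0 sr).
have ER : (\int[mu]_(s in `[0%R, t]) (\int[mu]_(r in `[s, t]) g (r, s))%:E =
    \int[mu]_s \int[mu]_r (h (r, s))%:E)%E.
  rewrite integral_mkcond; apply: eq_integral => s _; rewrite patchE.
  case: ifPn => [|/negP]; rewrite inE/= in_itv/=.
    move=> /andP[s0 st]; rewrite EFin_Rintegral// integral_mkcond.
    apply: eq_integral => r _; rewrite /h !patchE.
    rewrite (_ : (r \in _) = ((r, s) \in D)); first by case: ifP.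
    by apply/idP/idP; rewrite !inE/D/= in_itv/=; [move=> /andP[]|move=> [[_ ->]]].
  move=> st; rewrite integral0_eq// => r _; rewrite /h patchE ifF//.
  apply/negP; rewrite inE => -[[/= s0 sr] rt]; apply: st.
  by rewrite s0 (le_trans sr rt).
by rewrite /Rintegral EL ER ih.
Qed.

Lemma Rintegral_shift f s t : continuous f -> s <= t ->
  \int[mu]_(r in `[s, t]) f r = \int[mu]_(r in `[0, t - s]) f (r + s).
Proof.
move=> cf st; rewrite /Rintegral; congr fine.
have dF : ((fun r : R => r + s)^`()%classic : R -> R) = cst 1.
  by apply/funext => r; rewrite derive1E derive_val addr0.
have := @integration_by_substitution_increasing R (fun r => r + s) f 0 (t - s).
rewrite add0r subrK dF subr_ge0 => -> //; first last.
- exact: continuous_subspaceT.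
- split => //.
  + by apply: cvg_at_right_filter; apply: cvgD; [exact: cvg_id|exact: cvg_cst].
  + by apply: cvg_at_left_filter; apply: cvgD; [exact: cvg_id|exact: cvg_cst].
- exact: is_cvg_cst.
- exact: is_cvg_cst.
- by move=> r _; exact: cvg_cst.
- by move=> x y _ _; rewrite ltrD2r.
by apply: eq_integral => r _; rewrite mulrfctE/= mulr1.
Qed.

(** Both sides are the integral of [a (t - r) * b (r - s) * c s] over the triangle; after the swap,
    the inner variable is shifted by [s]. *)
Lemma tconvA a b c t : continuous a -> continuous b -> continuous c ->
  tconv a (tconv b c) t = tconv (tconv a b) c t.
Proof.
move=> ca cb cc.
pose g (p : R * R) := a (t - p.1) * (b (p.1 - p.2) * c p.2).
have [Ma MaE] := continuous_bounded_itv `|t| ca.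
have [Mb MbE] := continuous_bounded_itv `|t| cb.
have [Mc McE] := continuous_bounded_itv `|t| cc.
transitivity (\int[mu]_(r in `[0, t]) (\int[mu]_(s in `[0, r]) g (r, s))).
  apply: eq_Rintegral => r _; rewrite -RintegralZl//.
  exact/continuous_integrable/continuous_tconv_integrand.
rewrite (@Rintegral_triangle_swap g t (Ma * (Mb * Mc))).
- apply: eq_Rintegral => s; rewrite inE/= in_itv/= => /andP[s0 st].
  rewrite Rintegral_shift//; last first.
    move=> r; rewrite /continuous_at /g/=; apply: cvgM.
      apply: (cvg_continuous_comp ca).
      by apply: cvgB; [exact: cvg_cst|exact: cvg_id].
    apply: cvgM; last exact: cvg_cst.
    apply: (cvg_continuous_comp cb).
    by apply: cvgB; [exact: cvg_id|exact: cvg_cst].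
  rewrite -RintegralZr//; last first.
    exact/continuous_integrable/continuous_tconv_integrand.
  apply: eq_Rintegral => r _; rewrite /g/= addrK mulrA; congr (a _ * _ * _).
  by ring.
- apply: measurable_funM.
    apply: measurableT_comp; first exact: continuous_measurable_fun.
    exact: measurable_funB.
  apply: measurable_funM.
    apply: measurableT_comp; first exact: continuous_measurable_fun.
    exact: measurable_funB.
  apply: measurableT_comp => //; exact: continuous_measurable_fun.
- move=> r; apply: (@continuousZ _ (a (t - r)) (fun s => b (r - s) * c s)).
  exact: continuous_tconv_integrand.
- move=> s r; rewrite /continuous_at /g/=; apply: cvgM.
    apply: (cvg_continuous_comp ca).
    by apply: cvgB; [exact: cvg_cst|exact: cvg_id].
  apply: cvgM; last exact: cvg_cst.
  apply: (cvg_continuous_comp cb).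
  by apply: cvgB; [exact: cvg_id|exact: cvg_cst].
- move=> r s s0 sr rt; have tE : `|t| = t by rewrite ger0_norm; lra.
  rewrite /g/= normrM ler_pM//; first by apply: MaE; rewrite tE ler_norml; lra.
  by rewrite normrM ler_pM//; [apply: MbE|apply: McE]; rewrite tE ler_norml; lra.
Qed.

Lemma tconv1 b t : tconv (cst 1) b t = prim b t.
Proof. by apply: eq_prim => r _ _; rewrite mul1r. Qed.

(* Writing [a = k + 1 * a'] reduces Leibniz' rule to the associativity of the
   convolution and the fundamental theorem of calculus. *)
Lemma tconv_is_derive k a a' b t :
  continuous a -> continuous a' -> continuous b ->
  (forall s, 0 <= s -> a s = k + prim a' s) -> 0 < t ->
  is_derive t 1 (tconv a b) (k * b t + tconv a' b t).
Proof.
move=> ca ca' cb aE t0.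
have c1 : continuous (cst 1 : R -> R) by move=> ?; exact: cvg_cst.
have ck : continuous (cst k : R -> R) by move=> ?; exact: cvg_cst.
have cp := prim_continuous ca'; have cab := tconv_continuous ca' cb.
have E s : 0 <= s -> tconv a b s = prim (fun r => k * b r + tconv a' b r) s.
  move=> s0; rewrite (eq_tconv (a' := fun r => cst k r + tconv (cst 1) a' r) (b' := b))//.
    rewrite tconvDl//; last exact: tconv_continuous.
    rewrite -tconvA// tconv1 tconv_cst// primD//; last exact: continuousZ.
    by rewrite primZ.
  by move=> r r0 _; rewrite aE// tconv1.
have dp : is_derive t 1 (prim (fun r => k * b r + tconv a' b r)) (k * b t + tconv a' b t).
  apply: (@prim_is_derive _ (fun r => k * b r + tconv a' b r)) => //.
  by move=> r; apply: cvgD; [exact: continuousZ|exact: cab].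
apply: near_eq_is_derive dp; near=> s; rewrite E//.
by apply: ltW; near: s; exact: lt_nbhsr.
Unshelve. all: by end_near. Qed.

End ConvolutionAssoc.

(** * Derivatives of pointwise combinations of real functions *)

Section RealDerivatives.
Context {R : realType}.
Implicit Types (f g a b : R -> R) (t k df dg : R).

Lemma is_derive_add f g t df dg : is_derive t 1 f df -> is_derive t 1 g dg ->
  is_derive t 1 (fun s => f s + g s) (df + dg).
Proof. exact: is_deriveD. Qed.

Lemma is_derive_sub f g t df dg : is_derive t 1 f df -> is_derive t 1 g dg ->
  is_derive t 1 (fun s => f s - g s) (df - dg).
Proof. exact: is_deriveB. Qed.

Lemma is_derive_mul f g t df dg : is_derive t 1 f df -> is_derive t 1 g dg ->
  is_derive t 1 (fun s => f s * g s) (f t * dg + g t * df).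
Proof. exact: is_deriveM. Qed.

Lemma is_derive_scale k f t df : is_derive t 1 f df ->
  is_derive t 1 (fun s => k * f s) (k * df).
Proof. exact: is_deriveZ. Qed.

Lemma is_derive_bigsum (I : Type) (s : seq I) (f : I -> R -> R) (df : I -> R) t :
  (forall i, is_derive t 1 (f i) (df i)) ->
  is_derive t 1 (fun r => \sum_(i <- s) f i r) (\sum_(i <- s) df i).
Proof.
move=> fdf; elim: s => [|i s IH].
  under eq_fun do rewrite big_nil.
  by rewrite big_nil; exact: is_derive_cst.
under eq_fun do rewrite big_cons.
by rewrite big_cons; apply: is_derive_add.
Qed.

Lemma is_derive_expRM k t :
  is_derive t 1 (fun s => expR (k * s)) (k * expR (k * t)).
Proof.
have dk : is_derive t 1 ( *%R k) k.
  by apply: is_derive_eq; rewrite /GRing.scale/= mulr1.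
rewrite mulrC; exact: (is_derive1_comp (is_derive_expR (k * t)) dk).
Qed.

Lemma continuous_expRM k : continuous (fun s : R => expR (k * s)).
Proof.
move=> s; apply: (cvg_continuous_comp (@continuous_expR R)).
by apply: cvgM; [exact: cvg_cst|exact: cvg_id].
Qed.

Lemma derive_ge0_le f (df : R -> R) t : continuous f ->
  (forall s : R, 0 < s -> s < t -> is_derive s 1 f (df s)) ->
  (forall s : R, 0 < s -> s < t -> 0 <= df s) -> 0 <= t -> f 0 <= f t.
Proof.
move=> cf fdf df0 t0.
apply: (@ger0_derive1_ndecr R f 0 t) => //.
- by move=> s; rewrite in_itv/= => /andP[s0 st]; have [] := fdf s s0 st.
- move=> s; rewrite in_itv/= => /andP[s0 st]; rewrite derive1E.
  by have [_ ->] := fdf s s0 st; exact: df0.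
- exact: continuous_subspaceT.
Qed.

End RealDerivatives.

(** * Graph Laplacians as finite sums, and their bounds *)

Section Graph.
Context {R : realType} {V : choiceType}.
Implicit Types (X : set V) (w : V -> V -> R) (x y : V).

Definition neighbours X w x : seq V :=
  finmap.enum_fset (fset_set [set y | X y /\ w x y != 0]).

Lemma neighboursP X w x y : finite_set [set y | X y /\ w x y != 0] ->
  reflect (X y /\ w x y != 0) (y \in neighbours X w x).
Proof.
by move=> fw; rewrite /neighbours in_fset_set//; apply: (iffP idP); rewrite inE.
Qed.

Lemma fsbig_neighbours X w x (g : V -> R) :
  finite_set [set y | X y /\ w x y != 0] -> (forall y, w x y = 0 -> g y = 0) ->
  \sum_(y \in X) g y = \sum_(y <- neighbours X w x) g y.
Proof.
move=> fw g0; rewrite (@fsbigE _ _ _ _ _ (neighbours X w x))//.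
- rewrite [RHS]big_seq [LHS]big_seq_cond; apply: eq_bigl => y.
  apply/andP/idP => [[]//|yw]; split=> //.
  by have /(neighboursP _ fw)[Xy _] := yw; rewrite inE.
- exact: finmap.fset_uniq.
- by move=> y /= /(neighboursP _ fw)[].
- move=> y Xy yw; apply: g0; apply/eqP; apply: contraNT yw => wxy.
  exact/neighboursP.
Qed.

Lemma laplacianE X w f x : finite_set [set y | X y /\ w x y != 0] ->
  laplacian X w f x = \sum_(y <- neighbours X w x) (f x - f y) * w x y.
Proof. by move=> fw; apply: fsbig_neighbours => // y ->; rewrite mulr0. Qed.

Lemma laplacianB X w (f g : V -> R) x : finite_set [set y | X y /\ w x y != 0] ->
  laplacian X w (fun y => f y - g y) x = laplacian X w f x - laplacian X w g x.
Proof.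
by move=> fw; rewrite !laplacianE// -sumrB; apply: eq_bigr => y _; ring.
Qed.

Lemma valenceE X w x : finite_set [set y | X y /\ w x y != 0] ->
  valence X w x = \sum_(y <- neighbours X w x) w x y.
Proof. by move=> fw; exact: fsbig_neighbours. Qed.

(* [c - Laplacian] is a positive operator as soon as [c] bounds the valence. *)
Lemma norm_laplacian_shift X w (f : V -> R) x (c S : R) :
  weighted_graph X w -> finite_set [set y | X y /\ w x y != 0] ->
  X x -> valence X w x <= c -> (forall y, X y -> `|f y| <= S) ->
  `|c * f x - laplacian X w f x| <= c * S.
Proof.
move=> wX fw Xx vc fS; rewrite laplacianE//; move: vc; rewrite valenceE//.
set s := neighbours X w x => vc.
have -> : c * f x - \sum_(y <- s) (f x - f y) * w x y =
    (c - \sum_(y <- s) w x y) * f x + \sum_(y <- s) f y * w x y.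
  under eq_bigr do rewrite mulrBl.
  by rewrite sumrB -mulr_sumr; ring.
apply: le_trans (ler_normD _ _) _.
have -> : c * S = (c - \sum_(y <- s) w x y) * S + \sum_(y <- s) S * w x y.
  by rewrite -mulr_sumr; ring.
apply: lerD.
  by rewrite normrM ger0_norm ?subr_ge0// ler_wpM2l ?subr_ge0//; exact: fS.
apply: le_trans (ler_norm_sum _ _ _) _.
rewrite big_seq [leRHS]big_seq; apply: ler_sum => y /(neighboursP _ fw)[Xy _].
have [w0 _] := wX x y Xx Xy.
by rewrite normrM (ger0_norm w0) ler_wpM2r//; exact: fS.
Qed.

(** The constant 2 comes from the triangle inequality: the Laplacian is [c] minus an operator of
    norm at most [c]. *)
Lemma norm_laplacian X w (f : V -> R) x (c S : R) :
  weighted_graph X w -> finite_set [set y | X y /\ w x y != 0] ->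
  X x -> valence X w x <= c -> (forall y, X y -> `|f y| <= S) ->
  `|laplacian X w f x| <= 2 * c * S.
Proof.
move=> wX fw Xx vc fS; have := norm_laplacian_shift wX fw Xx vc fS.
have c0 : 0 <= c.
  apply: le_trans vc; rewrite valenceE// big_seq sumr_ge0// => y.
  by move=> /(neighboursP _ fw)[Xy _]; have [] := wX x y Xx Xy.
have : `|c * f x| <= c * S by rewrite normrM ger0_norm// ler_wpM2l//; exact: fS.
by rewrite !ler_norml; lra.
Qed.

End Graph.

(** * The maximum principle *)

Section HeatEquation.
Context {R : realType} {V : choiceType}.
Implicit Types (X : set V) (w : V -> V -> R) (x y : V) (t T : R).

(* With [c] a bound on the valence, [e^{ct} u] solves an equation whose right
   hand side is a positive operator of norm [c], so each integration in time
   improves the a priori bound [D (ct)^n / n!] by one power. *)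
Lemma maximum_principle X w (u : V -> R -> R) (B : R) :
  weighted_graph X w -> finite_valence X w ->
  (forall x, X x -> continuous (u x)) ->
  (forall x t, X x -> 0 < t ->
    is_derive t 1 (u x) (- laplacian X w (u^~ t) x)) ->
  (forall T, exists C : R, forall x t, X x -> 0 <= t -> t <= T -> `|u x t| <= C) ->
  (forall x, X x -> `|u x 0| <= B) ->
  forall x t, X x -> 0 <= t -> `|u x t| <= B.
Proof.
move=> wX [fw [M vM]] cu du ub u0B x0 t0 Xx0 t00.
have [C uC] := ub t0.
have B0 : 0 <= B := le_trans (normr_ge0 _) (u0B _ Xx0).
have C0 : 0 <= C := le_trans (normr_ge0 _) (uC _ _ Xx0 t00 (lexx _)).
pose c := Num.max 0 M.
have c0 : 0 <= c by rewrite /c le_max lexx.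
have vc x : X x -> valence X w x <= c by move=> Xx; rewrite /c le_max vM// orbT.
(* The a priori bound times the exponential weight at the final time: this makes the case [n = 0]
   hold on all of [[0, t0]]. *)
pose D := C * expR (c * t0).
have D0 : 0 <= D by rewrite mulr_ge0// expR_ge0.
pose h n t := B * expR (c * t) + D * ((c * t) ^+ n / n`!%:R).
have iter n : forall x t, X x -> 0 <= t -> t <= t0 ->
    expR (c * t) * `|u x t| <= h n t.
  elim: n => [|n IH] x t Xx t_ge0 tt0.
    rewrite /h expr0 fact0 divr1 mulr1 -[leLHS]add0r.
    apply: lerD; first by rewrite mulr_ge0// expR_ge0.
    rewrite /D mulrC; apply: ler_pM; rewrite ?expR_ge0//; first exact: uC.
    by rewrite ler_expR ler_wpM2l.
  (* The sign [e] reduces the two-sided bound to a one-sided one. The gap [g] below starts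
     nonnegative by the bound on the initial data, and its derivative is [c * h n] minus a term
     which positivity of [c - Laplacian] and the bound for [n] control. *)
  suff H (e : R) : `|e| = 1 -> e * (expR (c * t) * u x t) <= h n.+1 t.
    rewrite -(ger0_norm (expR_ge0 (c * t))) -normrM ler_norml.
    have := H 1 (normr1 _); have := H (-1); rewrite normrN1 => /(_ erefl).
    by rewrite mulN1r mul1r; lra.
  move=> e1.
  pose g s := B * expR (c * s) + D * ((c * s) ^+ n.+1 / n.+1`!%:R) -
     e * (expR (c * s) * u x s).
  have cg : continuous g.
    apply: continuous_funB; first apply: continuous_funD.
    - exact/continuousZ/continuous_expRM.
    - exact/continuousZ/continuous_exp_coeff.
    - apply/continuousZ/continuous_funM; last exact: cu.
      exact: continuous_expRM.
  pose dg s := B * (c * expR (c * s)) + D * (c * ((c * s) ^+ n / n`!%:R)) -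
     e * (expR (c * s) * (- laplacian X w (u^~ s) x) + u x s * (c * expR (c * s))).
  have gdg s : 0 < s -> s < t -> is_derive s 1 g (dg s).
    move=> s0 st; apply: is_derive_sub; first apply: is_derive_add.
    - exact/is_derive_scale/is_derive_expRM.
    - exact/is_derive_scale/is_derive_exp_coeff.
    - apply: is_derive_scale; apply: is_derive_mul; first exact: is_derive_expRM.
      exact: du.
  have dg0 s : 0 < s -> s < t -> 0 <= dg s.
    move=> s0 st.
    have E0 := expR_gt0 (c * s).
    have := @norm_laplacian_shift _ _ X w (u^~ s) x c (h n s / expR (c * s))
      wX (fw _ Xx) Xx (vc _ Xx).
    have -> : dg s = c * h n s -
        e * (expR (c * s) * (c * u x s - laplacian X w (u^~ s) x)).
      by rewrite /dg /h; ring.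
    move=> Hn; rewrite subr_ge0; apply: le_trans (ler_norm _) _.
    rewrite normrM e1 mul1r normrM (gtr0_norm E0) mulrC -ler_pdivlMr// -mulrA.
    apply: Hn => y Xy; rewrite ler_pdivlMr// mulrC; apply: IH => //; first exact: ltW.
    by apply: le_trans tt0; exact: ltW.
  have : g 0 <= g t by exact: (derive_ge0_le cg gdg dg0).
  rewrite -[e * (_ * _) <= _]subr_ge0 -/(g t); apply: le_trans.
  rewrite /g !mulr0 expR0 mul1r mulr1 expr0n/= mul0r mulr0 addr0 subr_ge0.
  by apply: le_trans (ler_norm _) _; rewrite normrM e1 mul1r; exact: u0B.
have E0 := expR_gt0 (c * t0).
rewrite -(ler_pM2r E0) mulrC.
(* The [D] term carries a general term of the exponential series and vanishes in the limit, so only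
   the initial bound survives. *)
have cvgh : h ^~ t0 @ \oo --> B * expR (c * t0).
  rewrite -[X in _ --> X]addr0; apply: cvgD; first exact: cvg_cst.
  rewrite -(mulr0 D); apply: cvgM; first exact: cvg_cst.
  exact: cvg_exp_coeff.
rewrite -(cvg_lim _ cvgh)//; apply: limr_ge; first exact: cvgP cvgh.
by near=> n; exact: iter.
Unshelve. all: by end_near. Qed.

End HeatEquation.

(** * The time derivative on the half-line *)

Section TimeDerivative.
Context {R : realType}.
Implicit Types (f g G : R -> R) (t d : R).

(** Properness is what makes the [lim] in [time_derive] equal to any limit found: every ball around
    [t] contains the later time [t + e / 2], also when [t = 0]. *)
Lemma within_itv_dnbhs_proper t : 0 <= t ->
  ProperFilter (within `[0, +oo[ (t^')).
Proof.
move=> t0; apply: Build_ProperFilter_ex => P.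
rewrite /within /= => -[e /= e0 He]; exists (t + e / 2).
apply: He; rewrite /ball_/=.
- by rewrite opprD addrA subrr add0r normrN gtr0_norm; lra.
- by apply/eqP; lra.
- by rewrite in_itv/= andbT; lra.
Qed.

(* The quotient only involves times [>= 0], so a function which extends
   differentiably past [t = 0] computes the one-sided derivative as well. *)
Lemma time_derive_val g G t d : 0 <= t -> is_derive t 1 G d ->
  (forall s, 0 <= s -> g s - g t = G s - G t) -> time_derive g t = d.
Proof.
move=> t0 [dG <-] gG; have PF := within_itv_dnbhs_proper t0.
apply: cvg_lim => //; apply/cvgrPdist_lt => e e0.
move: dG => /(@cvgrPdist_lt _ R)/(_ e e0)[d' /= d'0 Hd'].
exists d' => //= s sd st; rewrite in_itv/= andbT => s0.
have := Hd' (s - t); rewrite /ball_/= sub0r normrN distrC => /(_ sd).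
rewrite subr_eq0 => /(_ st); rewrite gG// /GRing.scale/= mulr1 subrK.
by rewrite [_ / _]mulrC.
Qed.

Lemma time_derive_derivable g t : 0 <= t -> derivable g t 1 ->
  time_derive g t = 'D_1 g t.
Proof.
by move=> t0 dg; apply: (time_derive_val t0 (G := g)) => //; exact: derivableP.
Qed.

Lemma time_derive_prim g f k t : continuous f -> 0 <= t ->
  (forall s, 0 <= s -> g s = k + prim f s) -> time_derive g t = f t.
Proof.
move=> cf t0 gE.
(* [prim f] is constant on negative times and may have a kink at 0; integrating from [-1] makes
   [t = 0] an interior point with a two-sided derivative. *)
pose G s := \int[lebesgue_measure]_(r in `[(-1), s]) f r.
have GE s : 0 <= s -> G s = G 0 + prim f s.
  move=> s0; rewrite /G /prim -(@Rintegral_itv_obnd_cbnd _ 0 (BRight s) f); last first.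
    have := continuous_integrable 0 s cf; apply: integrableS => //.
    by apply: subset_itv; rewrite bnd_simp.
  rewrite -(@Rintegral_itvB _ f (BLeft (-1)) (BRight s) 0) ?bnd_simp//.
  - by rewrite addrC subrK.
  - exact: continuous_integrable.
have N1t : -1 < t by lra.
have dG : is_derive t 1 G (f t).
  have [||//|d e] := @continuous_FTC1_closed _ f (-1) t (t + 1) _ _ N1t.
  - by lra.
  - exact: continuous_integrable.
  - exact: cf.
  - by apply: DeriveDef => //; rewrite -derive1E.
by apply: (time_derive_val t0 dG) => s s0; rewrite !gE// (GE s)// (GE t)//; ring.
Qed.

End TimeDerivative.

(** * Heat kernels extended to negative times *)

Section HeatKernel.
Context {R : realType} {V : choiceType}.
Implicit Types (X : set V) (w : V -> V -> R) (u v x y : V) (t T : R)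
  (H : V -> V -> R -> R).

(** Frozen at the initial value for negative times; the initial condition of a heat kernel is
    exactly what makes this continuous at 0. *)
Definition ext0 H u v t : R := H u v (Num.max 0 t).

Lemma ext0E H u v t : 0 <= t -> ext0 H u v t = H u v t.
Proof. by move=> t0; rewrite /ext0 max_r. Qed.

Lemma ext0_continuous X w H u v : heat_kernel X w H -> X u -> X v ->
  continuous (ext0 H u v).
Proof.
move=> hH Xu Xv t; have [t0|t0|<-] := ltgtP 0 t.
- have cH : {for t, continuous (H u v)}.
    exact/differentiable_continuous/derivable1_diffP/(heat_kernel_derivable hH Xu Xv t0).
  rewrite /continuous_at (ext0E _ _ _ (ltW t0)).
  apply: cvg_trans cH; apply: near_eq_cvg; near=> s; rewrite ext0E//.
  by apply: ltW; near: s; exact: lt_nbhsr.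
- have E s : s < 0 -> ext0 H u v s = ext0 H u v t.
    by move=> s0; rewrite /ext0 !max_l// ltW.
  have : (fun _ : R => ext0 H u v t) s @[s --> t] --> ext0 H u v t by exact: cvg_cst.
  by apply: cvg_trans; apply: near_eq_cvg; near=> s; rewrite E//; near: s; exact: lt_nbhsl.
- apply/left_right_continuousP; split.
    have : (fun _ : R => ext0 H u v 0) s @[s --> 0^'-] --> ext0 H u v 0.
      exact: cvg_cst.
    apply: cvg_trans; apply: near_eq_cvg; near=> s; rewrite /ext0 /= [in RHS]max_l//.
    by rewrite max_l//; near: s; exact: nbhs_left_le.
  rewrite ext0E// (heat_kernel_at0 hH Xu Xv).
  apply: cvg_trans (heat_kernel_lim0 hH Xu Xv); apply: near_eq_cvg.
  by near=> s; rewrite ext0E//; near: s; exact: nbhs_right_ge.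
Unshelve. all: by end_near. Qed.

Lemma laplacian_ext0 X w H v t x : 0 <= t ->
  laplacian X w (fun y => ext0 H y v t) x = laplacian X w (fun y => H y v t) x.
Proof.
by move=> t0; apply: eq_fsbigr => y _; rewrite !ext0E.
Qed.

Lemma ext0_is_derive X w H u v t : heat_kernel X w H -> X u -> X v -> 0 < t ->
  is_derive t 1 (ext0 H u v) (- laplacian X w (fun y => ext0 H y v t) u).
Proof.
move=> hH Xu Xv t0.
have dH := heat_kernel_derivable hH Xu Xv t0.
have := heat_kernel_eq hH Xu Xv t0.
rewrite /heat_op time_derive_derivable ?ltW// laplacian_ext0 ?ltW//.
move=> /eqP; rewrite addr_eq0 => /eqP->; rewrite opprK.
have : is_derive t 1 (H u v) ('D_1 (H u v) t) by exact: derivableP.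
apply: near_eq_is_derive; near=> s; rewrite ext0E//.
by apply: ltW; near: s; exact: lt_nbhsr.
Unshelve. all: by end_near. Qed.

Lemma continuous_laplacian X w (F : V -> R -> R) x :
  finite_set [set y | X y /\ w x y != 0] -> (forall y, continuous (F y)) ->
  continuous (fun t => laplacian X w (F^~ t) x).
Proof.
move=> fw cF; under eq_fun do rewrite laplacianE//.
apply: continuous_sum => y; apply: continuous_funM; last by move=> ?; exact: cvg_cst.
exact: continuous_funB.
Qed.

(** The integrated heat equation. It yields the one-sided derivative at [t = 0], and it is the
    decomposition of [a] that Leibniz' rule asks for. *)
Lemma ext0_prim w H u v t : finite_valence setT w -> heat_kernel setT w H ->
  0 <= t -> ext0 H u v t =
  (u == v)%:R + prim (fun s => - laplacian setT w (fun y => ext0 H y v s) u) t.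
Proof.
move=> [fw _] hH t0.
have cH x : continuous (ext0 H x v) by exact: ext0_continuous hH _ _.
have cL : continuous (fun s => - laplacian setT w (fun y => ext0 H y v s) u).
  move=> s; apply: cvgN.
  by apply: (@continuous_laplacian setT w (fun y => ext0 H y v) u) => //; exact: fw.
have dH (s : R) : 0 < s -> is_derive s 1 (ext0 H u v)
    (- laplacian setT w (fun y => ext0 H y v s) u) by exact: ext0_is_derive.
rewrite (prim_FTC2 cL (cH u) dH t0) (ext0E _ _ _ (lexx 0)).
by rewrite (heat_kernel_at0 hH) //; ring.
Qed.

Lemma norm_ext0 X w H : heat_kernel X w H ->
  exists2 M, 0 <= M & forall u v t, X u -> X v -> `|ext0 H u v t| <= M.
Proof.
move=> /heat_kernel_bounded[M HM]; exists `|M| => // u v t Xu Xv.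
by apply: le_trans (ler_norm _); apply: HM => //; rewrite le_max lexx.
Qed.

End HeatKernel.

(** * Matrices of functions multiplied by convolution *)

Section MatrixConvolution.
Context {R : realType} {T : Type} (B : seq T).
Implicit Types (F G H : T -> T -> R -> R) (u v : T) (t : R).

(** Only the contracted index is confined to [B]; the outer indices range over the whole type. *)
Definition mconv F G u v t := \sum_(x <- B) tconv (F u x) (G x v) t.

Lemma mconv_continuous F G u v : (forall x, continuous (F u x)) ->
  (forall x, continuous (G x v)) -> continuous (mconv F G u v).
Proof. by move=> cF cG; apply: continuous_sum => x; exact: tconv_continuous. Qed.

Lemma mconvA F G H u v t :
  (forall x y, continuous (F x y)) -> (forall x y, continuous (G x y)) ->
  (forall x y, continuous (H x y)) ->
  mconv F (mconv G H) u v t = mconv (mconv F G) H u v t.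
Proof.
move=> cF cG cH; rewrite /mconv.
under eq_bigr => x _.
  rewrite tconv_sumr//; last by move=> y; exact: tconv_continuous.
  under eq_bigr do rewrite tconvA//.
  over.
rewrite exchange_big /=; apply: eq_bigr => y _.
by rewrite tconv_suml//; move=> x; exact: tconv_continuous.
Qed.

Lemma mconv_sumr (n : nat) F (G : nat -> T -> T -> R -> R) (c : nat -> R) u v t :
  (forall x y, continuous (F x y)) -> (forall k x y, continuous (G k x y)) ->
  mconv F (fun x y s => \sum_(0 <= k < n) c k * G k x y s) u v t =
  \sum_(0 <= k < n) c k * mconv F (G k) u v t.
Proof.
move=> cF cG; rewrite /mconv.
under eq_bigr => x _.
  rewrite tconv_sumr//; last by move=> k; exact: continuousZ.
  under eq_bigr do rewrite tconvZr//.
  over.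
rewrite exchange_big /=; apply: eq_bigr => k _.
by rewrite mulr_sumr.
Qed.

End MatrixConvolution.

(** * The Neumann series of a bounded continuous matrix *)

Section NeumannSeries.
Context {R : realType} {T : Type} (B : seq T) (f : T -> T -> R -> R) (A : R).
Context (cf : forall u v, continuous (f u v)).
Context (fA : forall u v t, `|f u v t| <= A).
Implicit Types (u v : T) (t N : R) (k n : nat).

Definition mconv_pow k : T -> T -> R -> R := iter k (fun G => mconv B G f) f.

Definition neumann_term k u v t : R := (-1) ^+ k.+1 * mconv_pow k u v t.

Definition neumann u v t : R := limn (series (fun k => neumann_term k u v t)).

Lemma mconv_pow_continuous k u v : continuous (mconv_pow k u v).
Proof.
by elim: k u v => [|k IH] u v; [exact: cf|apply: mconv_continuous => x].
Qed.

Lemma mconv_powS k u v t : mconv_pow k.+1 u v t = mconv B f (mconv_pow k) u v t.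
Proof.
elim: k u v t => [//|k IH] u v t.
have -> : mconv_pow k.+1 = mconv B (mconv_pow k) f by [].
rewrite mconvA//; last exact: mconv_pow_continuous.
by apply: eq_bigr => x _; apply: eq_tconv => // r _ _; exact: IH.
Qed.

(** Each further convolution factor costs [A] for the entry and [size B] for the contraction. *)
Let K : R := A * (size B)%:R.

(** If [T] is empty, even a negative [A] satisfies the bound on [f]; hence the two points as
    arguments. *)
Let A0 u v : 0 <= A.
Proof. exact: le_trans (normr_ge0 _) (fA u v 0). Qed.

Lemma mconv_pow_bound k u v t :
  `|mconv_pow k u v t| <= A * ((K * `|t|) ^+ k / k`!%:R).
Proof.
elim: k u v t => [|k IH] u v t.
  by rewrite expr0 fact0 divr1 mulr1; exact: fA.
have K0 : 0 <= K by rewrite /K mulr_ge0// (A0 u v).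
have [t0|t0] := ltP t 0.
  rewrite mconv_powS /mconv big1 ?normr0; last by move=> x _; rewrite tconv0// ltW.
  by rewrite mulr_ge0 ?(A0 u v)// divr_ge0// exprn_ge0// mulr_ge0.
rewrite mconv_powS (ger0_norm t0) -prim_exp_coeff//.
apply: le_trans (ler_norm_sum _ _ _) _.
pose g s := A * ((K * s) ^+ k / k`!%:R).
have cg : continuous g by exact/continuousZ/continuous_exp_coeff.
have H x : `|tconv (f u x) (mconv_pow k x v) t| <= prim (fun s => A * g s) t.
  apply: le_tconv => //; first exact: mconv_pow_continuous.
  by move=> r r0 _; rewrite /g -{2}(ger0_norm r0); exact: IH.
apply: le_trans (ler_sum _ (fun x _ => H x)) _.
rewrite -primZ; last exact/continuousZ/continuous_exp_coeff.
rewrite big_const_seq count_predT iter_addr_0 -[leLHS]mulr_natl -primZ; last exact: continuousZ.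
rewrite le_eqVlt; apply/orP; left; apply/eqP; apply: eq_prim => r _ _.
by rewrite /g /K; ring.
Qed.

Definition majorant N k : R := A * exp_coeff (K * N) k.

Lemma neumann_term_le N k u v t : `|t| <= N ->
  `|neumann_term k u v t| <= majorant N k.
Proof.
move=> tN; rewrite normrM normrX normrN1 expr1n mul1r.
apply: le_trans (mconv_pow_bound _ _ _ _) _.
rewrite /majorant /exp_coeff /=; apply: ler_wpM2l; first exact: (A0 u v).
apply: ler_wpM2r; first by rewrite invr_ge0.
have K0 : 0 <= K by rewrite /K mulr_ge0// (A0 u v).
have N0 : 0 <= N by exact: le_trans (normr_ge0 t) tN.
apply: lerXn2r; rewrite ?nnegrE; [exact: mulr_ge0|exact: mulr_ge0|].
exact: ler_wpM2l.
Qed.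

Lemma is_cvg_series_majorant N : cvgn (series (majorant N)).
Proof. by apply: is_cvg_seriesZ; exact: is_cvg_series_exp_coeff. Qed.

Lemma normed_neumann_cvg u v t :
  cvgn [normed series (fun k => neumann_term k u v t)].
Proof.
apply: (@series_le_cvg R _ (majorant `|t|)).
- by move=> k; exact: normr_ge0.
- move=> k; apply: le_trans (neumann_term_le k u v (lexx _)); exact: normr_ge0.
- by move=> k; exact: neumann_term_le.
- exact: is_cvg_series_majorant.
Qed.

Lemma neumann_cvg u v t :
  series (fun k => neumann_term k u v t) @ \oo --> neumann u v t.
Proof. by have := normed_cvg (@normed_neumann_cvg u v t). Qed.

(** A remainder depending on [N] and [n] alone: it bounds the error for all pairs of vertices at
    once. *)
Definition tail N n : R := limn (series (majorant N)) - series (majorant N) n.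

Lemma tail_cvg N : tail N @ \oo --> 0.
Proof.
rewrite -(subrr (limn (series (majorant N)))).
by apply: cvgB; [exact: cvg_cst|exact: is_cvg_series_majorant].
Qed.

Lemma neumann_tail N n u v t : `|t| <= N ->
  `|neumann u v t - series (fun k => neumann_term k u v t) n| <= tail N n.
Proof.
move=> tN; set S := series _.
have cS : (fun m => `|S m - S n|) @ \oo --> `|neumann u v t - S n|.
  by apply: cvg_norm; apply: cvgB; [exact: neumann_cvg|exact: cvg_cst].
have cM : (fun m => series (majorant N) m - series (majorant N) n) @ \oo --> tail N n.
  by apply: cvgB; [exact: is_cvg_series_majorant|exact: cvg_cst].
rewrite -(cvg_lim _ cS)// -(cvg_lim _ cM)//; apply: ler_lim.
- exact: cvgP cS.
- exact: cvgP cM.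
near=> m.
have nm : (n <= m)%N by near: m; exact: nbhs_infty_ge.
rewrite !sub_series nm; apply: le_trans (ler_norm_sum _ _ _) _.
by apply: ler_sum => k _; exact: neumann_term_le.
Unshelve. all: by end_near. Qed.

Lemma neumann_bounded N : exists C : R, forall u v t, `|t| <= N ->
  `|neumann u v t| <= C.
Proof.
exists (tail N 0) => u v t tN; have := neumann_tail 0 u v tN.
by rewrite seriesEnat/= big_nil subr0.
Qed.

Lemma series_neumann_continuous n u v :
  continuous (fun t => series (fun k => neumann_term k u v t) n).
Proof.
by apply: continuous_sum => k; apply: continuousZ; exact: mconv_pow_continuous.
Qed.

Lemma neumann_continuous u v : continuous (neumann u v).
Proof.
(* A uniform limit of continuous functions, by an [e / 3] argument; times within 1 of [t] stay in
   the range where the tail bound applies. *)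
move=> t; apply/cvgrPdist_lt => e e0; pose N := `|t| + 1.
have e3 : 0 < e / 3 by lra.
have /cvgrPdist_lt/(_ _ e3)[n _ Hn] := tail_cvg N.
have {}Hn : tail N n < e / 3.
  by apply: le_lt_trans (Hn n (leqnn n)); rewrite sub0r normrN ler_norm.
have /cvgrPdist_lt/(_ _ e3) cS := @series_neumann_continuous n u v t.
near=> s.
have sN : `|s| <= N.
  have : `|t - s| < 1 by near: s; exists 1 => /=.
  by rewrite /N distrC; have := ler_normD (s - t) t; rewrite subrK; lra.
have tN : `|t| <= N by rewrite /N; lra.
have := neumann_tail n u v sN; have := neumann_tail n u v tN.
have : `|series (fun k => neumann_term k u v t) n -
    series (fun k => neumann_term k u v s) n| < e / 3 by near: s; exact: cS.
by rewrite !ltr_norml !ler_norml; lra.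
Unshelve. all: by end_near. Qed.

Lemma series_neumannS n u v t :
  series (fun k => neumann_term k u v t) n.+1 = - f u v t -
  mconv B f (fun x y s => series (fun k => neumann_term k x y s) n) u v t.
Proof.
rewrite /series /= big_nat_recl//= /neumann_term mconv_sumr//; last first.
  exact: mconv_pow_continuous.
rewrite expr1 mulN1r; congr (_ + _); rewrite -sumrN.
by apply: eq_bigr => k _; rewrite exprS mulN1r mulNr mconv_powS.
Qed.

(** Limit of the recursion for partial sums. The exchange with the integral is quantitative: on
    [[0, t]] the tail is a constant, so it enters the convolution with a factor [A * t] for each
    element of [B]. *)
Lemma neumann_volterra u v t : 0 <= t ->
  neumann u v t = - f u v t - mconv B f neumann u v t.
Proof.
move=> t0; set S := fun n x y s => series (fun k => neumann_term k x y s) n.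
have cS n x y : continuous (S n x y) by exact: series_neumann_continuous.
have cN := neumann_continuous.
have bd n : `|neumann u v t + f u v t + mconv B f neumann u v t| <=
    tail t n.+1 + (size B)%:R * (A * tail t n * t).
  have -> : neumann u v t + f u v t + mconv B f neumann u v t =
      (neumann u v t - S n.+1 u v t) +
      (mconv B f neumann u v t - mconv B f (S n) u v t).
    by rewrite /S series_neumannS; ring.
  apply: le_trans (ler_normD _ _) _; apply: lerD.
    by apply: neumann_tail; rewrite ger0_norm.
  rewrite /mconv -sumrB; apply: le_trans (ler_norm_sum _ _ _) _.
  have H x : `|tconv (f u x) (neumann x v) t - tconv (f u x) (S n x v) t| <=
      A * tail t n * t.
    rewrite -tconvBr//; apply: le_tconv_cst => //; first exact: continuous_funB.
    by move=> r r0 rt; apply: neumann_tail; rewrite ger0_norm.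
  apply: le_trans (ler_sum _ (fun x _ => H x)) _.
  by rewrite big_const_seq count_predT iter_addr_0 mulr_natl.
have cvg0 : (fun n => tail t n.+1 + (size B)%:R * (A * tail t n * t)) @ \oo --> 0.
  rewrite -(addr0 0); apply: cvgD.
    by rewrite (cvg_shiftS (tail t)); exact: tail_cvg.
  rewrite -[X in _ --> X](mulr0 (size B)%:R); apply: cvgM; first exact: cvg_cst.
  rewrite -[X in _ --> X](mul0r t); apply: cvgM; last exact: cvg_cst.
  rewrite -[X in _ --> X](mulr0 A); apply: cvgM; first exact: cvg_cst.
  exact: tail_cvg.
suff : `|neumann u v t + f u v t + mconv B f neumann u v t| <= 0.
  by rewrite normr_le0 => /eqP; lra.
rewrite -(cvg_lim _ cvg0)//; apply: limr_ge; first exact: cvgP cvg0.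
by apply: nearW => n; exact: bd.
Qed.

(** In [f * F] the first index is carried by [f], so a zero row of [f] gives a zero row of the
    series. This confines the sums in [Ht * F] to the boundary. *)
Lemma neumann0 u v t : 0 <= t -> (forall x s, f u x s = 0) -> neumann u v t = 0.
Proof.
move=> t0 fu; rewrite neumann_volterra// fu oppr0 sub0r /mconv big1 ?oppr0// => x _.
have c0 : continuous (f u x) by [].
rewrite (eq_tconv (a' := fun r => 0 * f u x r) (b' := neumann x v))//.
  by rewrite tconvZl ?mul0r//; exact: neumann_continuous.
by move=> r _ _; rewrite fu mul0r.
Qed.

End NeumannSeries.

(** * Comparison of a subgraph with its ambient graph *)

Section Subgraph.
Context {R : realType} {V : choiceType}.
Context (wt : V -> V -> R) (X : set V) (w : V -> V -> R).
Context (gt : weighted_graph setT wt) (ft : finite_valence setT wt).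
Context (sub : subgraph X w wt).
Implicit Types (x y u v : V) (phi : V -> R).

Let fwt x : finite_set [set y | setT y /\ wt x y != 0].
Proof. by case: ft => + _; apply. Qed.

(** Extending by 0 lets both Laplacians and valences be summed over the same list of ambient
    neighbours and compared term by term. *)
Let wb x y : R := if y \in X then w x y else 0.

Let wb_ge0 x y : X x -> 0 <= wb x y.
Proof.
by move=> Xx; rewrite /wb; case: ifPn => // /set_mem Xy; have [[]] := sub.1 x y Xx Xy.
Qed.

Let wb_le x y : X x -> wb x y <= wt x y.
Proof.
have [wt0 _] := @gt x y I I.
move=> Xx; rewrite /wb; case: ifPn => // /set_mem Xy.
by have [->//|->] := sub.2 x y Xx Xy.
Qed.

Let wb0 x y : X x -> wt x y = 0 -> wb x y = 0.
Proof.
move=> Xx wt0; apply/eqP; rewrite eq_le wb_ge0// andbT -wt0; exact: wb_le.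
Qed.

Let fsbig_sub x (c : V -> R) : X x ->
  \sum_(y \in X) c y * w x y = \sum_(y <- neighbours setT wt x) c y * wb x y.
Proof.
move=> Xx; rewrite fsbig_mkcond.
under eq_fsbigr => y _.
  rewrite (_ : patch _ _ _ _ = c y * wb x y); last first.
    by rewrite patchE /wb; case: ifP; rewrite ?mulr0.
  over.
by apply: fsbig_neighbours => // y wt0; rewrite wb0 ?mulr0.
Qed.

Lemma subgraph_laplacian phi x : X x -> laplacian X w phi x =
  \sum_(y <- neighbours setT wt x) (phi x - phi y) * wb x y.
Proof. exact: (@fsbig_sub x (fun y => phi x - phi y)). Qed.

Lemma subgraph_valence x : X x -> valence X w x =
  \sum_(y <- neighbours setT wt x) wb x y.
Proof.
move=> Xx; transitivity (\sum_(y \in X) cst 1 y * w x y).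
  by apply: eq_fsbigr => y _; rewrite mul1r.
by rewrite fsbig_sub//; apply: eq_bigr => y _; rewrite mul1r.
Qed.

Lemma subgraph_valence_le x : X x -> valence X w x <= valence setT wt x.
Proof.
move=> Xx; rewrite subgraph_valence// valenceE//; apply: ler_sum => y _.
exact: wb_le.
Qed.

Lemma subgraph_finite_valence : finite_valence X w.
Proof.
split=> [x Xx|].
  apply: sub_finite_set (fwt x) => y /= [Xy wxy]; split=> //.
  by have [<-|w0] := sub.2 x y Xx Xy => //; rewrite w0 eqxx in wxy.
case: ft => _ [M HM]; exists M => x Xx.
by apply: le_trans (HM x I); exact: subgraph_valence_le.
Qed.

(** Equal valences force equal weights: the differences [wt x y - wb x y] are nonnegative with sum
    0, so each one vanishes. *)
Lemma laplacian_interior phi x : X x -> ~ boundary X w wt x ->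
  laplacian X w phi x = laplacian setT wt phi x.
Proof.
move=> Xx nb; rewrite subgraph_laplacian// laplacianE//.
have : valence setT wt x <= valence X w x.
  by rewrite leNgt; apply/negP => lt; apply: nb.
rewrite subgraph_valence// valenceE// -subr_le0 -sumrB => le0.
have : \sum_(y <- neighbours setT wt x) (wt x y - wb x y) == 0.
  rewrite eq_le le0 sumr_ge0// => y _; rewrite subr_ge0; exact: wb_le.
rewrite psumr_eq0; last by move=> y _; rewrite subr_ge0; exact: wb_le.
move=> /allP ew; rewrite big_seq [RHS]big_seq; apply: eq_bigr => y /ew /=.
by rewrite subr_eq0 => /eqP ->.
Qed.

End Subgraph.

(** * Graph convolution as matrix convolution *)

Section GraphConvolution.
Context {R : realType} {V : choiceType}.
Implicit Types (X : set V) (F G : V -> V -> R -> R) (B : seq V).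

(** Passage from kernels controlled only on [X] and [t >= 0] to total continuous ones. Vanishing off
    [B] keeps the support of the summand finite, so the default value of the sum never occurs. *)
Lemma graph_convE X B F1 F2 G1 G2 u v (t : R) :
  uniq B -> (forall x, x \in B -> X x) ->
  (forall x, continuous (G1 u x)) -> (forall x, continuous (G2 x v)) ->
  (forall x r, X x -> 0 <= r -> F1 u x r = G1 u x r) ->
  (forall x r, X x -> 0 <= r -> F2 x v r = G2 x v r) ->
  (forall x r, X x -> x \notin B -> 0 <= r -> G2 x v r = 0) ->
  graph_conv X F1 F2 u v t = mconv B G1 G2 u v t.
Proof.
move=> uB BX c1 c2 e1 e2 z; rewrite /mconv /tconv -prim_sum; last first.
  by move=> x; exact: continuous_tconv_integrand.
apply: eq_Rintegral => r; rewrite inE/= in_itv/= => /andP[r0 rt].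
rewrite (@fsbigE _ _ _ _ _ B)//; last first.
  by move=> x Xx xB; rewrite e2// z// mulr0.
rewrite big_seq_cond [RHS]big_seq; apply: eq_big => [x|x /andP[xB _]].
  by apply/andP/idP => [[]//|xB]; split=> //; apply/mem_set/BX.
by rewrite e1 ?e2 ?subr_ge0//; exact: BX.
Qed.

End GraphConvolution.

(** * The corrected kernel and its heat equation *)

Section Parametrix.
Context {R : realType} {V : choiceType}.
Context (wt : V -> V -> R) (X : set V) (w : V -> V -> R) (H : V -> V -> R -> R).
Context (gt : weighted_graph setT wt) (ft : finite_valence setT wt).
Context (sub : subgraph X w wt) (hH : heat_kernel setT wt H).
Context (B : seq V) (uB : uniq B).
Context (BP : forall x, x \in B <-> boundary X w wt x).
Implicit Types (u v x y : V) (t r : R).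

Let Hc := ext0 H.

Let L u v t := laplacian setT wt (fun y => Hc y v t) u.

Let LX u v t := laplacian X w (fun y => Hc y v t) u.

(** The heat operator of the subgraph on the ambient kernel, with the time derivative replaced by
    minus the ambient Laplacian; in this form it is continuous at all times. *)
Definition defect u v t : R := if u \in X then LX u v t - L u v t else 0.

Let fX : finite_valence X w := subgraph_finite_valence gt ft sub.

Let BX x : x \in B -> X x.
Proof. by move=> /BP[]. Qed.

Let Hc_cont u v : continuous (Hc u v).
Proof. exact: (ext0_continuous hH). Qed.

Let L_cont u v : continuous (L u v).
Proof. by apply: continuous_laplacian => [|y]; [exact: ft.1|exact: Hc_cont]. Qed.

Let LX_cont u v : X u -> continuous (LX u v).
Proof.
by move=> Xu; apply: continuous_laplacian => [|y]; [exact: fX.1|exact: Hc_cont].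
Qed.

Let NL_cont u v : continuous (fun t => - L u v t).
Proof. by move=> t; apply: cvgN; exact: L_cont. Qed.

Lemma defect_continuous u v : continuous (defect u v).
Proof.
case: (boolP (u \in X)) => [/set_mem Xu|/negbTE Xu].
  rewrite (_ : defect u v = fun t => LX u v t - L u v t).
    by apply: continuous_funB; [exact: LX_cont|exact: L_cont].
  by apply/funext => t; rewrite /defect mem_set.
rewrite (_ : defect u v = fun=> 0); first by move=> t; exact: cvg_cst.
by apply/funext => t; rewrite /defect Xu.
Qed.

Lemma defect_bounded : exists A, forall u v t, `|defect u v t| <= A.
Proof.
have [M M0 HM] := norm_ext0 hH; have [c Hc'] := ft.2.
exists (`|2 * c * M| + `|2 * c * M|) => u v t; rewrite /defect.
case: ifPn => [/set_mem Xu|_]; last by rewrite normr0 addr_ge0.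
apply: le_trans (ler_normB _ _) _; apply: lerD; apply: le_trans (ler_norm _).
- apply: norm_laplacian => //; first exact: sub.1.
  + exact: fX.1.
  + exact: le_trans (subgraph_valence_le gt ft sub Xu) (Hc' u I).
  + by move=> y _; exact: HM.
- by apply: norm_laplacian => //; [exact: ft.1|exact: Hc'|move=> y _; exact: HM].
Qed.

Lemma defect_interior u v t : u \notin B -> defect u v t = 0.
Proof.
move=> uB'; rewrite /defect; case: ifPn => // /set_mem Xu.
have nb : ~ boundary X w wt u by move=> /BP; exact/negP.
by rewrite /LX (laplacian_interior gt ft sub _ Xu nb) subrr.
Qed.

(** At [t = 0] the heat equation is not asserted, yet the first term of the series is evaluated
    there; the integrated equation supplies the right derivative. *)
Lemma heat_op_defect u v t : X u -> 0 <= t -> heat_op X w H u v t = defect u v t.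
Proof.
move=> Xu t0; rewrite /heat_op /defect mem_set// /LX laplacian_ext0//.
congr (_ + _); apply: (@time_derive_prim _ _ (fun s => - L u v s) (u == v)%:R) => //.
by move=> s s0; rewrite -(ext0E H u v s0); exact: ext0_prim.
Qed.

Lemma graph_conv_pow_defect k u v t : X u -> X v -> 0 <= t ->
  graph_conv_pow X (heat_op X w H) k.+1 u v t = mconv_pow B defect k u v t.
Proof.
elim: k u v t => [|k IH] u v t Xu Xv t0; first exact: heat_op_defect.
apply: graph_convE => //.
- by move=> x; apply: mconv_pow_continuous => ? ?; exact: defect_continuous.
- by move=> x; exact: defect_continuous.
- by move=> x r Xx r0; exact: IH.
- by move=> x r Xx r0; exact: heat_op_defect.
- by move=> x r _ xB _; exact: defect_interior.
Qed.

Let F := neumann B defect.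

Lemma parametrix_termE k u v t : X u -> X v -> 0 <= t ->
  parametrix_term X w H k u v t = neumann_term B defect k u v t.
Proof.
by move=> Xu Xv t0; rewrite /parametrix_term graph_conv_pow_defect.
Qed.

Let F_cont u v : continuous (F u v).
Proof.
have [A HA] := defect_bounded.
exact: (neumann_continuous defect_continuous HA).
Qed.

Let F_interior u v t : u \notin B -> 0 <= t -> F u v t = 0.
Proof.
move=> uB' t0; have [A HA] := defect_bounded.
apply: (neumann0 _ defect_continuous HA) => // x s; exact: defect_interior.
Qed.

Definition corrected_kernel u v t := Hc u v t + mconv B Hc F u v t.

Let K := corrected_kernel.

Lemma corrected_kernel_continuous u v : continuous (K u v).
Proof. by apply: continuous_funD => //; exact: mconv_continuous. Qed.

Lemma corrected_kernel0 u v : K u v 0 = (u == v)%:R.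
Proof.
rewrite /K /corrected_kernel /mconv big1 ?addr0; last by move=> x _; exact: tconv0.
by rewrite /Hc ext0E// (heat_kernel_at0 hH).
Qed.

Lemma graph_conv_corrected u v t : X u -> X v -> 0 <= t ->
  H u v t + graph_conv X H F u v t = K u v t.
Proof.
move=> Xu Xv t0; rewrite /K /corrected_kernel -ext0E//; congr (_ + _).
apply: graph_convE => //.
- by move=> x r _ r0; rewrite /Hc ext0E.
- by move=> x r _ xB r0; exact: F_interior.
Qed.

Let mconvH_laplacian u v t : X u ->
  laplacian X w (fun y => K y v t) u = LX u v t + mconv B LX F u v t.
Proof.
move=> Xu; rewrite /LX laplacianE; last exact: fX.1.
set s := neighbours X w u.
rewrite /K /corrected_kernel laplacianE; last exact: fX.1.
have -> : mconv B (fun u0 v0 t0 => laplacian X w (fun y => Hc y v0 t0) u0) F u v t =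
   \sum_(y <- s) (mconv B Hc F u v t - mconv B Hc F y v t) * w u y.
  rewrite /mconv; under [RHS]eq_bigr do rewrite -sumrB mulr_suml.
  rewrite exchange_big; apply: eq_bigr => x _.
  transitivity (tconv (fun r => \sum_(y <- s) w u y * (Hc u x r - Hc y x r)) (F x v) t).
    apply: eq_tconv => // r _ _; rewrite laplacianE; last exact: fX.1.
    by apply: eq_bigr => y _; rewrite mulrC.
  rewrite tconv_suml//; last by move=> y; exact/continuousZ/continuous_funB.
  apply: eq_bigr => y _; rewrite tconvZl//; last exact: continuous_funB.
  by rewrite tconvBl// mulrC.
by rewrite -big_split /=; apply: eq_bigr => y _; ring.
Qed.

(** Leibniz' rule gives the derivative [- L + F - L * F]. Substituting [F = - f - f * F] with
    [f = LX - L] cancels every [L] and leaves [- LX - LX * F]. *)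
Lemma corrected_kernel_is_derive u v t : X u -> 0 < t ->
  is_derive t 1 (K u v) (- laplacian X w (fun y => K y v t) u).
Proof.
move=> Xu t0; have t0' := ltW t0; have [A HA] := defect_bounded.
have dH : is_derive t 1 (Hc u v) (- L u v t) by exact: (ext0_is_derive hH).
have dC : is_derive t 1 (mconv B Hc F u v)
    (\sum_(x <- B) ((u == x)%:R * F x v t + tconv (fun r => - L u x r) (F x v) t)).
  apply: is_derive_bigsum => x; apply: tconv_is_derive => // s s0.
  exact: ext0_prim.
have := is_derive_add dH dC.
rewrite (_ : - L u v t + _ = - laplacian X w (fun y => K y v t) u)//.
rewrite mconvH_laplacian// big_split/=.
(* The initial value of the ambient kernel is the identity matrix; for [u] off [B] no term matches,
   and [F u v t] is 0 as well. *)
have -> : \sum_(x <- B) (u == x)%:R * F x v t = F u v t.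
  case: (boolP (u \in B)) => uB'.
    rewrite (bigD1_seq u)//= eqxx mul1r big1 ?addr0// => x.
    by rewrite eq_sym => /negPf ->; rewrite mul0r.
  rewrite F_interior// big_seq big1// => x xB.
  by case: eqP => [ux|]; [rewrite ux xB in uB'|rewrite mul0r].
have -> : \sum_(x <- B) tconv (fun r => - L u x r) (F x v) t = - mconv B L F u v t.
  rewrite /mconv -sumrN; apply: eq_bigr => x _; rewrite -mulN1r -tconvZl//.
  by apply: eq_tconv => // r _ _; rewrite mulN1r.
rewrite {1}/F (neumann_volterra _ defect_continuous HA)// -/F.
have -> : mconv B defect F u v t = mconv B LX F u v t - mconv B L F u v t.
  rewrite /mconv -sumrB; apply: eq_bigr => x _; rewrite -tconvBl//; last exact: LX_cont.
  by apply: eq_tconv => // r _ _; rewrite /defect mem_set.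
by rewrite /defect mem_set//; ring.
Qed.

Lemma corrected_kernel_locally_bounded (T : R) :
  exists C : R, forall u v t, 0 <= t -> t <= T -> `|K u v t| <= C.
Proof.
have [A HA] := defect_bounded; have [M M0 HM] := norm_ext0 hH.
have [C HC] := neumann_bounded B defect_continuous HA T.
exists (M + (size B)%:R * (M * `|C| * T)) => u v t t0 tT.
apply: le_trans (ler_normD _ _) _; apply: lerD; first exact: HM.
apply: le_trans (ler_norm_sum _ _ _) _.
have bd x : `|tconv (Hc u x) (F x v) t| <= M * `|C| * T.
  apply: (@le_trans _ _ (M * `|C| * t)); last by rewrite ler_wpM2l// mulr_ge0.
  apply: le_tconv_cst => // [r _ _|r r0 rt]; first exact: HM.
  apply: le_trans (ler_norm _); apply: HC.
  by rewrite ger0_norm// (le_trans rt).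
apply: le_trans (ler_sum _ (fun x _ => bd x)) _.
by rewrite big_const_seq count_predT iter_addr_0 mulr_natl.
Qed.

(** The constant 1 bounds the Kronecker delta at time 0; the second vertex is a parameter of the
    maximum principle. *)
Lemma corrected_kernel_bounded u v t : X u -> X v -> 0 <= t -> `|K u v t| <= 1.
Proof.
move=> Xu Xv.
apply: (maximum_principle (u := fun x s => K x v s) sub.1 fX) => //.
- by move=> x _; exact: corrected_kernel_continuous.
- by move=> x s Xx s0; exact: corrected_kernel_is_derive.
- move=> T; have [C HC] := corrected_kernel_locally_bounded T.
  by exists C => x s Xx; exact: HC.
- by move=> x _; rewrite corrected_kernel0; case: eqP; rewrite ?normr1 ?normr0.
Qed.

Lemma heat_kernel_corrected :
  heat_kernel X w (fun u v t => H u v t + graph_conv X H F u v t).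
Proof.
have E u v : X u -> X v -> forall t, 0 <= t ->
  H u v t + graph_conv X H F u v t = K u v t by move=> *; exact: graph_conv_corrected.
split.
- move=> u v t Xu Xv t0; have [dK _] := corrected_kernel_is_derive v Xu t0.
  apply: near_eq_derivable dK; near=> s; rewrite E//.
  by apply: ltW; near: s; exact: lt_nbhsr.
- move=> u v t Xu Xv t0; have t0' := ltW t0; rewrite /heat_op.
  rewrite (time_derive_val t0' (corrected_kernel_is_derive v Xu t0)); last first.
    by move=> s s0; rewrite !E.
  apply/eqP; rewrite subr_eq0; apply/eqP; apply: eq_fsbigr => y /set_mem Xy.
  by rewrite !E.
- move=> u v Xu Xv; rewrite -corrected_kernel0.
  have := cvg_at_right_filter (@corrected_kernel_continuous u v 0).
  by apply: cvg_trans; apply: near_eq_cvg; near=> s; rewrite E.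
- by move=> u v Xu Xv; rewrite E// corrected_kernel0.
- by exists 1 => u v t Xu Xv t0; rewrite E//; exact: corrected_kernel_bounded.
Unshelve. all: by end_near. Qed.

(** The difference of the two kernels has zero initial data, so the maximum principle applies with
    bound 0. *)
Lemma heat_kernel_unique_corrected HG u v t : heat_kernel X w HG ->
  X u -> X v -> 0 <= t -> HG u v t = H u v t + graph_conv X H F u v t.
Proof.
move=> hG Xu Xv t0; rewrite graph_conv_corrected// -(ext0E HG u v t0).
have [M M0 HM] := norm_ext0 hG.
apply/eqP; rewrite -subr_eq0 -normr_le0.
apply: (maximum_principle (u := fun x s => ext0 HG x v s - K x v s) sub.1 fX) => //.
- move=> x Xx; apply: continuous_funB; first exact: ext0_continuous hG _ _.
  exact: corrected_kernel_continuous.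
- move=> x s Xx s0.
  have := is_derive_sub (ext0_is_derive hG Xx Xv s0) (corrected_kernel_is_derive v Xx s0).
  rewrite (_ : _ - _ = - laplacian X w (fun y => ext0 HG y v s - K y v s) x)//.
  by rewrite laplacianB; [ring|exact: fX.1].
- move=> T; have [C HC] := corrected_kernel_locally_bounded T.
  exists (M + C) => x s Xx s0 sT.
  apply: le_trans (ler_normB _ _) _; apply: lerD; [exact: HM|exact: HC].
- move=> x Xx; rewrite corrected_kernel0 ext0E// (heat_kernel_at0 hG)//.
  by rewrite subrr normr0.
Qed.

End Parametrix.

(** The error estimates for the series are uniform in the vertices, so a compact set enters them
    through its range of times. *)
Lemma compact_time_bounded (R : realType) (S : topologicalType) (K : set (S * R)) :
  compact K -> exists N : R, forall p, K p -> `|p.2| <= N.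
Proof.
move=> cK; have : compact (snd @` K).
  by apply: continuous_compact => //; apply: continuous_subspaceT => p; exact: cvg_snd.
move=> /compact_bounded[M [_ HM]]; exists (M + 1) => p Kp.
by apply: (HM (M + 1)); [lra|exists p].
Qed.

Theorem proposition12 (R : realType) (V : discreteTopologicalType)
    (wt : V -> V -> R) (VG : set V) (w : V -> V -> R)
    (Ht : V -> V -> R -> R) :
  weighted_graph setT wt ->
  finite_valence setT wt ->
  bounded_degree setT wt ->
  subgraph VG w wt ->
  infinite_set VG ->
  finite_set (boundary VG w wt) ->
  heat_kernel setT wt Ht ->
  exists Ft : V -> V -> R -> R,
    (forall K : set (V * V * R),
       K `<=` VG `*` VG `*` `[0, +oo[ ->
       compact K ->
       (forall p, K p ->
          cvgn [normed series
                 (fun k => parametrix_term VG w Ht k p.1.1 p.1.2 p.2)]) /\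
       {uniform K,
          (fun n (p : V * V * R) =>
             series (fun k => parametrix_term VG w Ht k p.1.1 p.1.2 p.2) n)
            @ \oo --> (fun p : V * V * R => Ft p.1.1 p.1.2 p.2)}) /\
    heat_kernel VG w (fun v1 v2 t => Ht v1 v2 t + graph_conv VG Ht Ft v1 v2 t) /\
    (forall HG : V -> V -> R -> R, heat_kernel VG w HG ->
       forall v1 v2 t, VG v1 -> VG v2 -> 0 <= t ->
         HG v1 v2 t = Ht v1 v2 t + graph_conv VG Ht Ft v1 v2 t).
Proof.
move=> gt ft _ sub _ fB hH.
pose B : seq V := finmap.enum_fset (fset_set (boundary VG w wt)).
have uB : uniq B by exact: finmap.fset_uniq.
have BP x : x \in B <-> boundary VG w wt x.
  by rewrite /B in_fset_set// inE.
pose f := defect wt VG w Ht.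
have cf u v : continuous (f u v) by exact: defect_continuous.
have [A fA] : exists A, forall u v t, `|f u v t| <= A by exact: defect_bounded.
exists (neumann B f); split; last split.
- move=> K KG cK.
  have E p : K p -> (fun k => parametrix_term VG w Ht k p.1.1 p.1.2 p.2) =
      (fun k => neumann_term B f k p.1.1 p.1.2 p.2).
    move=> /KG[[/= Xu Xv]]; rewrite in_itv/= andbT => t0.
    by apply/funext => k; exact: parametrix_termE.
  split=> [p Kp|]; first by rewrite E//; exact: normed_neumann_cvg cf fA _ _ _.
  have [N KN] := compact_time_bounded cK.
  (* A uniform neighbourhood amounts to some [e]; once the majorant tail is below [e], the partial
     sums are [e]-close at all points of [K] together. *)
  move=> P /uniform_nbhs[D [+ DP]]; rewrite -entourage_ballE => -[e /= e0 eD].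
  have /cvgrPdist_lt/(_ _ e0) ct := @tail_cvg _ _ B A N.
  near=> n; apply: DP => p Kp; apply: eD; rewrite /ball/= E//.
  apply: le_lt_trans (neumann_tail _ cf fA n _ _ (KN p Kp)) _.
  apply: le_lt_trans (ler_norm _) _; rewrite -normrN -sub0r.
  by near: n.
- exact: heat_kernel_corrected.
- by move=> HG hG u v t Xu Xv t0; exact: heat_kernel_unique_corrected.
Unshelve. all: by end_near. Qed.
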